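(* Let $R$ be a right perfect ring and let $M$ be a right $R$-module. Then $M$ is automorphism-coinvariant if and only if $M$ is pseudo-projective.
   Context: All rings are associative with identity and all modules are unitary right modules. Over a right perfect ring every right module $M$ has a projective cover, i.e. an epimorphism $p:P\rightarrow M$ with $P$ projective such that every homomorphism from a projective module to $M$ factors through $p$ and, whenever $h:P\to P$ satisfies $p=p\circ h$, $h$ is an automorphism (equivalently, $P$ is projective and $p$ is an epimorphism with superfluous kernel). A module $M$ with projective cover $p:P\rightarrow M$ is called automorphism-coinvariant if for every automorphism $\varphi:P\rightarrow P$ there exists an endomorphism $f:M\rightarrow M$ such that $f\circ p=p\circ\varphi$. A module $M$ is called pseudo-projective if for every submodule $N$ of $M$ and every epimorphism $\varphi:M\rightarrow M/N$ there exists a homomorphism $\psi:M\rightarrow M$ lifting $\varphi$, i.e. with $\pi\circ\psi=\varphi$, where $\pi:M\rightarrow M/N$ is the canonical projection. *)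

(* Defs.v *)
From HB Require Import structures.
From mathcomp Require Import all_boot all_order all_algebra.
Set Implicit Arguments.
Unset Strict Implicit.
Unset Printing Implicit Defensive.
Import GRing.Theory.
Local Open Scope ring_scope.
Local Open Scope quotient_scope.

(* Everything is stated for [lmodType S] with S an arbitrary, possibly
   noncommutative, ring. A right module over R is an [lmodType R^c], where R^c
   is the opposite ring: v . a is written (a : R^c) *: v. The type [pzRingType]
   is used instead of [nzRingType] so that the zero ring is not excluded. *)

(* A submodule is a [submodClosed], i.e. a boolean predicate; under excluded
   middle this covers every submodule.
   In the library [submodClosed] does not inherit from [zmodClosed], which the
   quotient of an abelian group requires; [submod_pred N] is N with that
   structure added. *)
Definition submod_pred (S : pzRingType) (M : lmodType S) (N : submodClosed M) :
  {pred M} := fun x => x \in N.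

Lemma submod_pred_closed (S : pzRingType) (M : lmodType S)
  (N : submodClosed M) : zmod_closed (submod_pred N).
Proof.
split=> [|x y Nx Ny]; first exact: (rpred0 N).
by rewrite -[x - y]/(x + - y) -scaleN1r; apply: (rpredD Nx); apply: rpredZ.
Qed.

HB.instance Definition _ (S : pzRingType) (M : lmodType S)
    (N : submodClosed M) :=
  GRing.isZmodClosed.Build M (submod_pred N) (submod_pred_closed N).

Section QuotientModule.
Variables (S : pzRingType) (M : lmodType S) (N : submodClosed M).

Definition quotmod : Type := Quotient.quot (submod_pred N : zmodClosed M).

HB.instance Definition _ := GRing.Zmodule.on quotmod.

Definition quotmod_proj (x : M) : quotmod :=
  \pi_(Quotient.quot (submod_pred N : zmodClosed M)) x.

Lemma quotmod_projP (x y : M) :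
  (quotmod_proj x = quotmod_proj y) <-> (x - y \in N).
Proof.
rewrite /quotmod_proj; split=> [/eqP|Nxy].
  by rewrite -Quotient.idealrBE.
by apply/eqP; rewrite -Quotient.idealrBE.
Qed.

Lemma quotmod_proj_surj (u : quotmod) : exists x, quotmod_proj x = u.
Proof. by exists (repr (u : Quotient.quot _)); apply: reprK. Qed.

Lemma quotmod_proj_is_zmod_morphism : zmod_morphism quotmod_proj.
Proof. exact: pi_is_zmod_morphism. Qed.

HB.instance Definition _ :=
  GRing.isZmodMorphism.Build M quotmod quotmod_proj
    quotmod_proj_is_zmod_morphism.

Definition quotmod_scale (a : S) (u : quotmod) : quotmod :=
  quotmod_proj (a *: repr (u : Quotient.quot (submod_pred N : zmodClosed M))).

Lemma quotmod_scaleE (a : S) (x : M) :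
  quotmod_scale a (quotmod_proj x) = quotmod_proj (a *: x).
Proof.
apply/quotmod_projP; rewrite -scalerBr; apply: rpredZ.
by apply/quotmod_projP; apply: reprK.
Qed.

Lemma quotmod_scalerA a b u :
  quotmod_scale a (quotmod_scale b u) = quotmod_scale (a * b) u.
Proof.
by have [x <-] := quotmod_proj_surj u; rewrite !quotmod_scaleE scalerA.
Qed.

Lemma quotmod_scale1r : left_id 1 quotmod_scale.
Proof.
by move=> u; have [x <-] := quotmod_proj_surj u; rewrite quotmod_scaleE scale1r.
Qed.

Lemma quotmod_scalerDr : right_distributive quotmod_scale +%R.
Proof.
move=> a u v; have [x <-] := quotmod_proj_surj u.
have [y <-] := quotmod_proj_surj v.
by rewrite -raddfD !quotmod_scaleE -raddfD scalerDr.
Qed.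

Lemma quotmod_scalerDl u : {morph quotmod_scale^~ u : a b / a + b}.
Proof.
move=> a b; have [x <-] := quotmod_proj_surj u.
by rewrite !quotmod_scaleE -raddfD scalerDl.
Qed.

HB.instance Definition _ := GRing.Zmodule_isLmodule.Build S quotmod
  quotmod_scalerA quotmod_scale1r quotmod_scalerDr quotmod_scalerDl.

Lemma quotmod_proj_is_scalable : scalable quotmod_proj.
Proof. by move=> a x; rewrite -[RHS]/(quotmod_scale _ _) quotmod_scaleE. Qed.

HB.instance Definition _ :=
  GRing.isScalable.Build S M quotmod *:%R quotmod_proj
    quotmod_proj_is_scalable.

End QuotientModule.

Section Modules.
Variable S : pzRingType.

Definition epimorphism (A B : lmodType S) (f : {linear A -> B}) : Prop :=
  forall y, exists x, f x = y.

(* The inverse of a bijective linear map is linear. *)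
Definition automorphism (A : lmodType S) (f : {linear A -> A}) : Prop :=
  bijective f.

Definition projective (P : lmodType S) : Prop :=
  forall (A B : lmodType S) (g : {linear A -> B}) (f : {linear P -> B}),
    epimorphism g -> exists h : {linear P -> A}, g \o h =1 f.

Definition projective_cover (P M : lmodType S) (p : {linear P -> M}) : Prop :=
  [/\ projective P,
      epimorphism p,
      forall (Q : lmodType S) (f : {linear Q -> M}),
        projective Q -> exists g : {linear Q -> P}, p \o g =1 f
    & forall h : {linear P -> P}, p =1 p \o h -> automorphism h].

Definition coinvariant_along (P M : lmodType S) (p : {linear P -> M}) : Prop :=
  forall phi : {linear P -> P}, automorphism phi ->
    exists f : {linear M -> M}, f \o p =1 p \o phi.

Definition automorphism_coinvariant (M : lmodType S) : Prop :=
  exists (P : lmodType S) (p : {linear P -> M}),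
    projective_cover p /\ coinvariant_along p.

(* The projective cover chosen in [automorphism_coinvariant] is immaterial. *)
Lemma automorphism_coinvariantE (P M : lmodType S) (p : {linear P -> M}) :
  projective_cover p -> automorphism_coinvariant M <-> coinvariant_along p.
Proof.
move=> covp; split=> [[P' [p' [covp' co]]]|co]; last by exists P, p.
case: covp => prP _ liftp minp; case: covp' => prP' _ liftp' minp'.
have [a pa] := liftp' _ p prP; have [b pb] := liftp _ p' prP'.
have autba : automorphism (b \o a).
  by apply: minp => x; rewrite -[RHS]/((p \o b) (a x)) pb -pa.
have autab : automorphism (a \o b).
  by apply: minp' => x; rewrite -[RHS]/((p' \o a) (b x)) pa -pb.
have bija : bijective a.
  case: autba => c ca1 _; case: autab => d _ cd.
  have bda y : c (b y) = b (d y) by rewrite -{1}[y]cd /=; apply: ca1.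
  exists (c \o b) => [x|y] /=; first exact: ca1.
  by rewrite bda; apply: cd.
move=> phi autphi; case: (bija) => c ac ca.
have linc : linear c := can2_linear ac ca.
pose cl : {linear P' -> P} :=
  HB.pack c (GRing.isLinear.Build S P' P *:%R c linc).
have [|f fE] := co (a \o phi \o cl).
  by apply: bij_comp; [apply: bij_comp|exists a].
exists f => x /=.
by have := fE (a x); rewrite /= ac; have := pa x; have := pa (phi x) => /= -> ->.
Qed.

Definition pseudo_projective (M : lmodType S) : Prop :=
  forall (N : submodClosed M) (phi : {linear M -> quotmod N}),
    epimorphism phi ->
    exists psi : {linear M -> M}, quotmod_proj N \o psi =1 phi.

End Modules.

Definition right_perfect (R : pzRingType) : Prop :=
  forall M : lmodType R^c,
    exists (P : lmodType R^c) (p : {linear P -> M}), projective_cover p.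

(* Main.v *)
Require Import Defs.
From mathcomp Require Import all_boot all_order all_algebra.
From HB Require Import structures.
From mathcomp Require Import boolp classical_sets functions.
Set Implicit Arguments.
Unset Strict Implicit.
Unset Printing Implicit Defensive.
Import GRing.Theory.
Local Open Scope ring_scope.

(** Let p : P -> M be a projective cover with kernel L.

    A pseudo-projective module is coinvariant by a superfluity argument. For
    an automorphism phi of P, the map p \o phi induces an epimorphism from M
    onto M/N with N = p (phi L). It lifts to psi : M -> M, and psi lifts to
    h : P -> P. Wherever p h and p phi differ, they differ by an element of
    p (phi L), and h L is contained in L; hence p h and p phi agree on a
    submodule that together with L generates P. As L is superfluous they agree
    everywhere, so psi \o p = p \o phi (pseudo_projective_coinvariant_along).

    Conversely, suppose that M is coinvariant and let phi : M -> M/N be an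
    epimorphism. The endomorphisms of P that induce an endomorphism of M form a
    ring containing all automorphisms, so it suffices to lift phi \o p along
    the projection P -> M -> M/N to an endomorphism of P in the additive span
    of the automorphisms. Both epimorphisms P -> M/N factor through the
    projective cover Q of M/N by split epimorphisms a and b, with sections i
    and j. For x = i b and y = j a, the map x + (1 - x y) is such a lift. In
    general it is not an automorphism: the complements of Q in P
    given by a and by b need not be isomorphic when P is not finitely generated.
    It is nevertheless a sum of automorphisms and their opposites, as follows.

    Over a perfect ring, the radical Z of P (the sum of its superfluous
    submodules) is superfluous (radical_superfluous) and V = P/Z is semisimple
    (semisimple_top). Endomorphisms of V lift to P, automorphisms of V lift to
    automorphisms, and a map with image in Z is the difference of two
    automorphisms. So the question concerns the ring E of endomorphisms of V,
    which is von Neumann regular. Let I be the largest ideal of E inside the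
    span of the units. Every corner e E (1 - e) lies in I
    (unit_ideal_corner), so idempotents are central modulo I and
    x + (1 - x y) is right invertible modulo I.

    It remains to see that an element u right invertible modulo I lies in
    the span, and this is where more than regularity is used: by Zorn's lemma V
    contains a maximal submodule of the form A + B with A and B independent
    and isomorphic. The projection onto A + B lies in I, and a complement D of
    A + B contains no two independent isomorphic nonzero submodules, so that
    its endomorphism ring is reduced (exists_reduced_corner). Modulo I, u may be
    replaced by an element of the reduced regular ring End D, where every
    element is a unit minus an idempotent, and that idempotent falls in I
    (unit_span_right_invertible_mod). *)

(** * The span of the units of a regular ring *)

Section UnitSpan.
Variable E : pzRingType.
Implicit Types e f g h k n p q u v w x y : E.

Definition invertible u := exists2 v, u * v = 1 & v * u = 1.

Inductive unit_span : E -> Prop :=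
| unit_span0 : unit_span 0
| unit_span_add u g : invertible u -> unit_span g -> unit_span (u + g).

Lemma unit_span_unit u : invertible u -> unit_span u.
Proof. by move=> uu; rewrite -[u]addr0; apply: unit_span_add => //; left. Qed.

Lemma unit_spanD g h : unit_span g -> unit_span h -> unit_span (g + h).
Proof.
move=> sg sh; elim: sg => [|u g' uu _ IH]; first by rewrite add0r.
by rewrite -addrA; apply: unit_span_add.
Qed.

Lemma invertibleN u : invertible u -> invertible (- u).
Proof. by case=> v uv vu; exists (- v); rewrite mulrNN. Qed.

Lemma invertibleM u v : invertible u -> invertible v -> invertible (u * v).
Proof.
move=> [u' uu' u'u] [v' vv' v'v]; exists (v' * u').
  by rewrite mulrA -(mulrA u) vv' mulr1.
by rewrite mulrA -(mulrA v') u'u mulr1.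
Qed.

Lemma invertible1 : invertible 1. Proof. by exists 1; rewrite mulr1. Qed.

Lemma unit_spanN g : unit_span g -> unit_span (- g).
Proof.
elim=> [|u h uu _ IH]; first by rewrite oppr0; left.
by rewrite opprD; apply: unit_span_add IH; apply: invertibleN.
Qed.

Lemma unit_spanB g h : unit_span g -> unit_span h -> unit_span (g - h).
Proof. by move=> sg sh; apply/unit_spanD/unit_spanN. Qed.

Lemma unit_spanM g h : unit_span g -> unit_span h -> unit_span (g * h).
Proof.
move=> sg sh; elim: sg => [|u g' uu _ IH]; first by rewrite mul0r; left.
rewrite mulrDl; apply: unit_spanD IH.
elim: sh => [|v h' vu _ IH]; first by rewrite mulr0; left.
by rewrite mulrDr; apply: unit_span_add IH; apply: invertibleM.
Qed.

(** The element e h f has square zero, so it is (1 + e h f) - 1, a difference of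
    units. *)
Lemma unit_span_corner e h f : f * e = 0 -> unit_span (e * h * f).
Proof.
move=> fe0; set n := e * h * f.
have nn : n * n = 0 by rewrite /n -!mulrA (mulrA f) fe0 mul0r !mulr0.
have -> : n = (1 + n) - 1 by rewrite addrC addKr.
apply: unit_spanB; apply: unit_span_unit; last exact: invertible1.
exists (1 - n); first by rewrite mulrBr mulr1 mulrDl mul1r nn addr0 addrK.
by rewrite mulrBl mul1r mulrDr mulr1 nn addr0 addrK.
Qed.

(** The largest two-sided ideal contained in the span of the units. *)
Definition unit_ideal h := forall p q, unit_span (p * h * q).

Lemma unit_ideal_span h : unit_ideal h -> unit_span h.
Proof. by move/(_ 1 1); rewrite mul1r mulr1. Qed.

Lemma unit_idealD h k : unit_ideal h -> unit_ideal k -> unit_ideal (h + k).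
Proof. by move=> ih ik p q; rewrite mulrDr mulrDl; apply: unit_spanD. Qed.

Lemma unit_idealN h : unit_ideal h -> unit_ideal (- h).
Proof. by move=> ih p q; rewrite mulrN mulNr; apply: unit_spanN. Qed.

Lemma unit_idealB h k : unit_ideal h -> unit_ideal k -> unit_ideal (h - k).
Proof. by move=> ih ik; apply/unit_idealD/unit_idealN. Qed.

Lemma unit_idealMl p h : unit_ideal h -> unit_ideal (p * h).
Proof. by move=> ih p' q; rewrite mulrA. Qed.

Lemma unit_idealMr h q : unit_ideal h -> unit_ideal (h * q).
Proof. by move=> ih p q'; rewrite mulrA -mulrA. Qed.

Hypothesis regE : forall n, exists k, n * k * n = n.

Lemma idempotent_complement e : e * e = e -> (1 - e) * (1 - e) = 1 - e.
Proof. by move=> ee; rewrite mulrBl mul1r mulrBr mulr1 ee subrr subr0. Qed.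

(** In the Peirce decomposition of the ring along e, every product p n q with
    n in the corner e E (1 - e) is a sum of products of off-diagonal elements,
    each of which has square zero. The diagonal components of n q and p n
    acquire this form once n is written n k n, with k taken in the opposite
    corner. *)
Lemma unit_ideal_corner e h : e * e = e -> unit_ideal (e * h * (1 - e)).
Proof.
move=> ee; have [f fE] : exists f, f = 1 - e by exists (1 - e).
rewrite -fE; have ef : e * f = 0 by rewrite fE mulrBr mulr1 ee subrr.
have fe : f * e = 0 by rewrite fE mulrBl mul1r ee subrr.
have splitl p : p = e * p + f * p by rewrite -mulrDl fE subrKC mul1r.
have splitr p : p = p * e + p * f by rewrite -mulrDr fE subrKC mulr1.
have ff : f * f = f by rewrite {1}fE mulrBl mul1r ef subr0.
have [n nE] : exists n, n = e * h * f by exists (e * h * f).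
rewrite -nE; have sn : unit_span n by rewrite nE; apply: unit_span_corner.
have en : e * n = n by rewrite nE !mulrA ee.
have nf : n * f = n by rewrite nE -mulrA ff.
(* A generalized inverse of n can be cut down to the corner f E e. *)
have [k [fk ke nkn]] : exists k, [/\ f * k = k, k * e = k & n * k * n = n].
  have [k nkn] := regE n; exists (f * k * e); split.
  - by rewrite !mulrA ff.
  - by rewrite -mulrA ee.
  - by rewrite !mulrA nf -(mulrA _ e) en.
have sk : unit_span k by rewrite -fk -ke mulrA; apply: unit_span_corner.
have snq q : unit_span (n * q).
  rewrite [n * q]splitr; apply: unit_spanD; last first.
    by rewrite -en -(mulrA e); apply: unit_span_corner.
  have -> : n * q * e = n * (f * (k * n * q) * e) by rewrite !mulrA nf nkn.
  by apply: (unit_spanM sn); apply: unit_span_corner.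
have spn p : unit_span (p * n).
  rewrite [p * n]splitl; apply: unit_spanD.
    by rewrite -nf (mulrA p) (mulrA e); apply: unit_span_corner.
  have -> : f * (p * n) = f * (p * n * k) * e * n.
    by rewrite -!mulrA (mulrA k) ke (mulrA n) nkn.
  by apply: unit_spanM => //; apply: unit_span_corner.
move=> p q; have -> : p * n * q = p * n * k * (n * q).
  by rewrite -{1}nkn !mulrA.
by apply: unit_spanM => //; apply: unit_spanM.
Qed.

(** The difference consists of the two off-diagonal components of h in the
    Peirce decomposition along e, up to sign. *)
Lemma unit_ideal_comm e h : e * e = e -> unit_ideal (e * h - h * e).
Proof.
move=> ee; set f := 1 - e.
have ff : f * f = f by apply: idempotent_complement.
have -> : e * h - h * e = e * h * (1 - e) - f * h * (1 - f).
  have -> : 1 - f = e by rewrite /f opprB addrC subrK.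
  by rewrite mulrBr mulr1 /f mulrBl mul1r mulrBl opprB addrA subrK.
by apply: unit_idealB; apply: unit_ideal_corner.
Qed.

Variable d : E.
Hypothesis dd : d * d = d.
Hypothesis ideal_d : unit_ideal (1 - d).
Hypothesis reduced_d : forall n, d * n * d = n -> n * n = 0 -> n = 0.

(** Modulo the ideal, u is an element a of the corner d E d. As that corner is
    regular and reduced, a = g - (1 - e) with g a unit of E and e the idempotent
    a w = w a, for w a generalized inverse of a. Since e a = a and a is right
    invertible modulo the ideal, 1 - e lies in the ideal. *)
Lemma unit_span_right_invertible_mod u v :
  unit_ideal (u * v - 1) -> unit_span u.
Proof.
move=> iuv; have [a aE] : exists a, a = d * u * d by exists (d * u * d).
have iua : unit_ideal (u - a).
  have -> : u - a = (1 - d) * u + (d * u) * (1 - d).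
    by rewrite aE mulrBr mulr1 mulrBl mul1r addrA subrK.
  by apply: unit_idealD; [apply: unit_idealMr|apply: unit_idealMl].
have da : d * a = a by rewrite aE !mulrA dd.
have ad : a * d = a by rewrite aE -mulrA dd.
have [w [awa waw dw wd]] : exists w,
    [/\ a * w * a = a, w * a * w = w, d * w = w & w * d = w].
  have [k aka] := regE a; exists (d * k * a * k * d); split.
  - by rewrite !mulrA ad -(mulrA _ d) da aka.
  - rewrite -!mulrA (mulrA a d) ad (mulrA d a) da.
    by do 2!rewrite (mulrA a k) (mulrA (a * k) a) aka.
  - by rewrite !mulrA dd.
  - by rewrite -mulrA dd.
(* Both a - a a w and a - w a a have square zero. *)
have aaw : a = a * a * w.
  apply/eqP; rewrite -subr_eq0; apply/eqP; apply: reduced_d.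
    by rewrite mulrBr mulrBl da ad !mulrA da -(mulrA _ w) wd.
  have -> : a - a * a * w = a * (1 - a * w) by rewrite mulrBr mulr1 mulrA.
  by rewrite mulrA -(mulrA a) mulrBl mul1r awa subrr mulr0 mul0r.
have waa : a = w * a * a.
  apply/eqP; rewrite -subr_eq0; apply/eqP; apply: reduced_d.
    by rewrite mulrBr mulrBl da ad !mulrA dw -(mulrA _ a d) ad.
  have -> : a - w * a * a = (1 - w * a) * a by rewrite mulrBl mul1r.
  rewrite mulrA -(mulrA _ a) mulrBr mulr1 (mulrA a w) awa subrr mulr0.
  by rewrite mul0r.
pose e := a * w.
have eE : e = w * a by rewrite /e {1}waa [in RHS]aaw !mulrA.
have ae : a * e = a by rewrite eE mulrA.
have ea : e * a = a by [].
have ew : e * w = w by rewrite eE.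
have we : w * e = w by rewrite /e mulrA.
have ee : e * e = e by rewrite {2}/e mulrA ea.
have ff := idempotent_complement ee.
have inv1 p q : p * e = p -> e * q = q -> p * q = e ->
    (p + (1 - e)) * (q + (1 - e)) = 1.
  move=> pe eq pq; rewrite mulrDl (mulrDr p) (mulrDr (1 - e)) ff pq.
  by rewrite (mulrBr p) mulr1 pe subrr addr0 mulrBl mul1r eq subrr add0r subrKC.
have ig : invertible (a + (1 - e)) by exists (w + (1 - e)); apply: inv1.
have ie : unit_ideal (1 - e).
  have -> : 1 - e = (1 - e) * (u - a) * v - (1 - e) * (u * v - 1).
    have ea0 : (1 - e) * a = 0 by rewrite mulrBl mul1r ea subrr.
    rewrite mulrBr ea0 subr0 -mulrA.
    by rewrite -mulrBr opprB subrKC mulr1.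
  by apply: unit_idealB; [apply: unit_idealMr|]; apply: unit_idealMl.
have -> : u = (u - a) + ((a + (1 - e)) - (1 - e)) by rewrite addrK subrK.
apply: unit_spanD; first exact: unit_ideal_span.
by apply: unit_spanB; [apply: unit_span_unit|apply: unit_ideal_span].
Qed.

(** Modulo the ideal, e = x y is central, and y + (1 - e) is a right inverse of
    x + (1 - e). *)
Lemma unit_span_partial_iso x y :
  x * y * x = x -> y * x * y = y -> unit_span (x + (1 - x * y)).
Proof.
move=> xyx yxy; pose e := x * y; rewrite -/e.
have ee : e * e = e by rewrite /e mulrA xyx.
have ex : e * x = x by [].
have ye : y * e = y by rewrite mulrA.
apply: (@unit_span_right_invertible_mod _ (y + (1 - e))).
have -> : (x + (1 - e)) * (y + (1 - e)) - 1
    = (e * x - x * e) - (e * y - y * e).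
  have ff := idempotent_complement ee.
  rewrite mulrDl (mulrDr x) (mulrDr (1 - e)) ff -/e (mulrBr x) mulr1 mulrBl.
  by rewrite mul1r ex ye opprB (addrC e) addrACA subrKC addrK.
by apply: unit_idealB; apply: unit_ideal_comm.
Qed.

End UnitSpan.

(** * Submodules and linear maps *)

Section Submodules.
Variable S : pzRingType.
Implicit Types V W A P Q : lmodType S.

(** Submodules as propositional predicates, which can be formed by existential
    quantification; submodule_submodClosed passes to boolean ones. *)
Definition submodule V (X : set V) :=
  X 0 /\ forall a x y, X x -> X y -> X (a *: x + y).

Lemma submodule0 V (X : set V) : submodule X -> X 0.
Proof. by case. Qed.

Lemma submoduleD V (X : set V) x y : submodule X -> X x -> X y -> X (x + y).
Proof. by move=> [_ sX] Xx Xy; rewrite -[x]scale1r; apply: sX. Qed.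

Lemma submoduleZ V (X : set V) a x : submodule X -> X x -> X (a *: x).
Proof. by move=> [X0 sX] Xx; rewrite -[_ *: _]addr0; apply: sX. Qed.

Lemma submoduleN V (X : set V) x : submodule X -> X x -> X (- x).
Proof. by move=> sX Xx; rewrite -scaleN1r; apply: submoduleZ. Qed.

Lemma submoduleB V (X : set V) x y : submodule X -> X x -> X y -> X (x - y).
Proof. by move=> sX Xx Xy; apply: submoduleD => //; apply: submoduleN. Qed.

Lemma submodule_submodClosed V (X : set V) :
  submodule X -> exists N : submodClosed V, forall x, (x \in N) <-> X x.
Proof.
move=> sX; pose B : {pred V} := fun x => `[< X x >].
have cB : GRing.subsemimod_closed B.
  split; first split=> [|x y].
  - by apply/asboolP; apply: submodule0.
  - by move=> /asboolP Xx /asboolP Xy; apply/asboolP; apply: submoduleD.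
  - by move=> a x /asboolP Xx; apply/asboolP; apply: submoduleZ.
pose N : submodClosed V := HB.pack B (GRing.isSubmodClosed.Build S V B cB).
by exists N => x; split=> [/asboolP|Xx]; last exact/asboolP.
Qed.

Section SubmoduleType.
Variables (V : lmodType S) (N : submodClosed V).
Definition submodule_type : Type := {x : V | x \in N}.
HB.instance Definition _ := SubChoice.on submodule_type.
HB.instance Definition _ := [SubChoice_isSubLmodule of submodule_type by <:].
End SubmoduleType.

Lemma linear_of V W (f : V -> W) :
  linear f -> exists g : {linear V -> W}, g =1 f.
Proof.
move=> lf.
by exists (HB.pack f (GRing.isLinear.Build S V W *:%R f lf) : {linear V -> W}).
Qed.

(** The first projection from the graph G to P is onto, and a section of it
    followed by the second projection selects values linearly. *)
Lemma projective_selection P A (G : set (P * A)) :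
  projective P -> submodule G -> (forall x, exists y, G (x, y)) ->
  exists h : {linear P -> A}, forall x, G (x, h x).
Proof.
move=> prP /submodule_submodClosed[N NE] totG.
pose g : {linear submodule_type N -> P} := fst \o \val.
have [|s gs] := prP _ _ g (idfun : {linear P -> P}).
  move=> x; have [y /NE Nxy] := totG x.
  by exists (exist _ (x, y) Nxy).
exists (snd \o \val \o s : {linear P -> A}) => x; apply/NE.
by have := valP (s x); have := gs x => /=; case: (val _) => /= ? ? ->.
Qed.

End Submodules.

(** * The endomorphism ring of a semisimple module *)

Section EndoRing.
Variables (S : pzRingType) (V : lmodType S).

Lemma linear_ext (f g : {linear V -> V}) : f =1 g -> f = g.
Proof.
case: f g => [f [[[f0 fD]] [fZ]]] [g [[[g0 gD]] [gZ]]] /= /funext fg.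
case: _ / fg g0 gD gZ => g0 gD gZ.
by rewrite (Prop_irrelevance g0 f0) (Prop_irrelevance gD fD)
  (Prop_irrelevance gZ fZ).
Qed.

(** The alias carries the ring structure, whose product is composition. *)
Definition endo : Type := {linear V -> V}.
HB.instance Definition _ := gen_eqMixin endo.
HB.instance Definition _ := gen_choiceMixin endo.

Implicit Types f g h : endo.
Definition endo_add f g : endo := f \+ g.
Definition endo_opp f : endo := \- f.
Definition endo_zero : endo := \0.
Definition endo_mul f g : endo := f \o g.
Definition endo_one : endo := idfun.

Fact endo_addA : associative endo_add.
Proof. by move=> f g h; apply: linear_ext => x /=; rewrite addrA. Qed.
Fact endo_addC : commutative endo_add.
Proof. by move=> f g; apply: linear_ext => x /=; rewrite addrC. Qed.
Fact endo_add0 : left_id endo_zero endo_add.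
Proof. by move=> f; apply: linear_ext => x /=; rewrite add0r. Qed.
Fact endo_addN : left_inverse endo_zero endo_opp endo_add.
Proof. by move=> f; apply: linear_ext => x /=; rewrite addNr. Qed.
HB.instance Definition _ :=
  GRing.isZmodule.Build endo endo_addA endo_addC endo_add0 endo_addN.

Fact endo_mulA : associative endo_mul.
Proof. by move=> f g h; apply: linear_ext. Qed.
Fact endo_mul1 : left_id endo_one endo_mul.
Proof. by move=> f; apply: linear_ext. Qed.
Fact endo_mulr1 : right_id endo_one endo_mul.
Proof. by move=> f; apply: linear_ext. Qed.
Fact endo_mulDl : left_distributive endo_mul +%R.
Proof. by move=> f g h; apply: linear_ext. Qed.
Fact endo_mulDr : right_distributive endo_mul +%R.
Proof. by move=> f g h; apply: linear_ext => x; apply: (linearD f). Qed.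
HB.instance Definition _ := GRing.Zmodule_isPzRing.Build endo
  endo_mulA endo_mul1 endo_mulr1 endo_mulDl endo_mulDr.

Lemma endo_eqP (f g : endo) : f = g <-> f =1 g.
Proof. by split=> [->|/linear_ext]. Qed.
Lemma endo_addE f g x : (f + g) x = f x + g x. Proof. by []. Qed.
Lemma endo_subE f g x : (f - g) x = f x - g x. Proof. by []. Qed.
Lemma endo_mulE f g x : (f * g) x = f (g x). Proof. by []. Qed.
Lemma endo_1E x : (1 : endo) x = x. Proof. by []. Qed.

End EndoRing.

Section Semisimple.
Variables (S : pzRingType) (V : lmodType S).

Definition semisimple := forall X : set V, submodule X ->
  exists Y : set V, [/\ submodule Y,
    forall v, exists x y, [/\ X x, Y y & v = x + y]
    & forall v, X v -> Y v -> v = 0].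

Hypothesis ssV : semisimple.

(** Values can be chosen in a complement of the submodule of all y with
    G (0, y). They are then unique, and hence depend linearly on x. *)
Lemma semisimple_selection (G : set (V * V)) :
  submodule G -> (forall x, exists y, G (x, y)) ->
  exists h : endo V, forall x, G (x, h x).
Proof.
move=> sG totG.
have sK : submodule [set y | G (0, y)].
  split=> [|a x y /= Gx Gy]; first exact: (submodule0 sG).
  have -> : (0, a *: x + y) = a *: (0, x) + (0, y) :> V * V.
    by congr pair; rewrite /= scaler0 addr0.
  by apply: submoduleD => //; apply: submoduleZ.
have [D [sD KD KD0]] := ssV sK.
have ex x : {y | G (x, y) /\ D y}.
  apply: cid; have [y Gxy] := totG x; have [k [y' [/= Gk Dy yE]]] := KD y.
  exists y'; split=> //; have -> : y' = y - k by rewrite yE addrC addKr.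
  by have := submoduleB sG Gxy Gk; congr G; congr pair; rewrite /= subr0.
pose h x := sval (ex x).
have hP x : G (x, h x) /\ D (h x) := svalP (ex x).
have hE x y : G (x, y) -> D y -> y = h x.
  move=> Gxy Dy; have [Gh Dh] := hP x; apply/eqP; rewrite -subr_eq0; apply/eqP.
  apply: KD0; last exact: submoduleB.
  by have := submoduleB sG Gxy Gh; congr G; congr pair; rewrite /= subrr.
have [|h' h'E] := @linear_of _ _ _ h.
  move=> a x y; symmetry; have [Gx Dx] := hP x; have [Gy Dy] := hP y.
  apply: hE; last by apply: submoduleD => //; apply: submoduleZ.
  exact: submoduleD (submoduleZ a sG Gx) Gy.
by exists h' => x; rewrite h'E; have [] := hP x.
Qed.

(** A generalized inverse maps x to a preimage under n of its component in the
    image of n, relative to a complement of that image. *)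
Lemma semisimple_regular (n : endo V) : exists k, n * k * n = n.
Proof.
have sI : submodule [set y | exists x, y = n x].
  split=> [|a _ _ [x ->] [y ->]]; first by exists 0; rewrite linear0.
  by exists (a *: x + y); rewrite linearP.
have [C [sC IC IC0]] := ssV sI.
have [||k kE] := @semisimple_selection [set p | C (p.1 - n p.2)].
- split=> [|a [x y] [x' y'] /= Cx Cy].
    by rewrite /= linear0 subr0; apply: submodule0.
  have -> : a *: x + x' - n (a *: y + y') = a *: (x - n y) + (x' - n y').
    by rewrite linearP opprD addrACA -scalerBr.
  by apply: submoduleD => //; apply: submoduleZ.
- move=> x; have [_ [c [[y ->] Cc ->]]] := IC x; exists y.
  by rewrite /= addrAC subrr add0r.
exists k; apply/endo_eqP => x; rewrite !endo_mulE; apply/esym/eqP.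
rewrite -subr_eq0; apply/eqP/IC0; last exact: (kE (n x)).
by exists (x - k (n x)); rewrite linearB.
Qed.

End Semisimple.

(** * Maximal pairs of independent isomorphic submodules *)

Section Pairings.
Variables (S : pzRingType) (V : lmodType S).
Local Open Scope classical_set_scope.

(** The condition says that G is the graph of an isomorphism A -> B between
    submodules with A and B independent: applied to the pair (0, 0) it gives
    injectivity and single-valuedness, and in general A and B meet in 0. Stated
    this way it involves two elements of G at a time, so that it is preserved
    by unions of chains. *)
Definition pairing (G : set (V * V)) :=
  submodule G /\ forall x y z, G (x, y) -> G (y, z) -> x = 0 /\ z = 0.

Lemma exists_maximal_pairing :
  exists2 G, pairing G & forall H, pairing H -> G `<=` H -> H `<=` G.
Proof.
pose P (G : set (V * V)) := (forall a p q, G p -> G q -> G (a *: p + q)) /\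
  forall x y z, G (x, y) -> G (y, z) -> x = 0 /\ z = 0.
have [F FP totF|G [[linG sepG] maxG]] := @Zorn_bigcup _ P.
  have chain p q : (\bigcup_(X in F) X) p -> (\bigcup_(X in F) X) q ->
      exists X, [/\ F X, X p & X q].
    move=> [X FX Xp] [Y FY Yq]; case: (totF X Y FX FY) => [XY|YX].
      by exists Y; split=> //; apply: XY.
    by exists X; split=> //; apply: YX.
  split=> [a p q Fp Fq|x y z Fp Fq].
    have [X [FX Xp Xq]] := chain _ _ Fp Fq; exists X => //.
    by have [lX _] := FP X FX; apply: lX.
  have [X [FX Xp Xq]] := chain _ _ Fp Fq; have [_ sX] := FP X FX.
  exact: sX Xp Xq.
exists G.
  (* The empty chain forces Zorn's lemma to range over possibly empty relations;
     a maximal one contains 0. *)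
  split=> //; split=> //; apply: contrapT => nG0.
  apply: (maxG [set 0]); last first.
    split=> [a p q /= -> ->|x y z /= [-> _] [_ ->] //].
    by rewrite scaler0 addr0.
  split=> [|/(_ 0 erefl) //].
  move=> p Gp; case: nG0.
  by have := linG (-1) _ _ Gp Gp; rewrite scaleN1r addNr.
move=> H [[_ linH] sepH] GH; apply: contrapT => nHG.
by apply: (maxG H); split.
Qed.

(** For a maximal pairing G, an isomorphism A -> B, and a complement D of
    A + B, let s be G on A and 0 on B + D, let t be the inverse of G on B and 0
    on A + D, and let d = 1 - (s t + t s) be the projection onto D. Since
    s = (s t) s (1 - s t) is off-diagonal, s and therefore 1 - d lie in the
    ideal. An endomorphism n of D with n n = 0 restricts to an isomorphism from
    a complement of its kernel onto its image, two independent submodules; this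
    would enlarge G if n were not 0. *)
Lemma exists_reduced_corner : semisimple V -> exists d : endo V,
  [/\ d * d = d, unit_ideal (1 - d)
    & forall n, d * n * d = n -> n * n = 0 -> n = 0].
Proof.
move=> ssV; have [G pG maxG] := exists_maximal_pairing.
have [sG sepG] := pG.
have G00 : G (0, 0) := submodule0 sG.
have GL c a b a' b' : G (a, b) -> G (a', b') -> G (c *: a + a', c *: b + b').
  by move=> Gab; apply: sG.2 Gab.
have GB a b a' b' : G (a, b) -> G (a', b') -> G (a - a', b - b').
  exact: submoduleB.
pose X := [set x | exists a b a' b', [/\ G (a, b), G (a', b') & x = a + b']].
have sX : submodule X.
  split; first by exists 0, 0, 0, 0; rewrite addr0.
  move=> c _ _ [a1 [b1 [a2 [b2 [G1 G2 ->]]]]] [a3 [b3 [a4 [b4 [G3 G4 ->]]]]].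
  exists (c *: a1 + a3), (c *: b1 + b3), (c *: a2 + a4), (c *: b2 + b4).
  by split; [exact: GL|exact: GL|rewrite scalerDr addrACA].
have [D [sD XD XD0]] := ssV X sX.
have dec x : exists a b a' b' d,
    [/\ G (a, b), G (a', b'), D d & x = a + b' + d].
  have [_ [d [[a [b [a' [b' [G1 G2 ->]]]]] Dd ->]]] := XD x.
  by exists a, b, a', b', d.
(* A, B and D are independent. *)
have dec0 a b a' b' d : G (a, b) -> G (a', b') -> D d -> a + b' + d = 0 ->
    b = 0 /\ a' = 0.
  move=> G1 G2 Dd e0; have d0 : d = 0.
    apply: XD0 => //; exists (- a), (- b), (- a'), (- b'); split.
    - by have := GB _ _ _ _ G00 G1; rewrite !sub0r.
    - by have := GB _ _ _ _ G00 G2; rewrite !sub0r.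
    - by apply/eqP; rewrite -opprD -addr_eq0 addrC e0.
  have ab : a = - b' by apply/eqP; rewrite -addr_eq0 -e0 d0 addr0.
  have G3 : G (- a', a) by have := GB _ _ _ _ G00 G2; rewrite !sub0r ab.
  by have [/eqP + ->] := sepG _ _ _ G3 G1; rewrite oppr_eq0 => /eqP.
have decU a b a' b' d a1 b1 a1' b1' d1 : G (a, b) -> G (a', b') -> D d ->
    G (a1, b1) -> G (a1', b1') -> D d1 -> a + b' + d = a1 + b1' + d1 ->
    b = b1 /\ a' = a1'.
  move=> G1 G2 Dd G3 G4 Dd1 e.
  have [||||/subr0_eq -> /subr0_eq ->//] :=
    dec0 (a - a1) (b - b1) (a' - a1') (b' - b1') (d - d1).
  - exact: GB.
  - exact: GB.
  - exact: submoduleB.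
  - by rewrite (addrACA a) -opprD addrACA -opprD e subrr.
have [||s sP] := @semisimple_selection _ _ ssV
  [set p | exists a a' b' d,
     [/\ G (a, p.2), G (a', b'), D d & p.1 = a + b' + d]].
- split=> [|c [? b1] [? b2]].
    by exists 0, 0, 0, 0; split=> //; [exact: submodule0|rewrite !addr0].
  move=> [a1 [a1' [b1' [d1 [/= G1 G1' D1 ->]]]]].
  move=> [a2 [a2' [b2' [d2 [/= G2 G2' D2 ->]]]]].
  exists (c *: a1 + a2), (c *: a1' + a2'), (c *: b1' + b2'), (c *: d1 + d2).
  split; [exact: GL|exact: GL|exact: sD.2|].
  by rewrite /= !scalerDr addrACA (addrACA (c *: a1)).
- move=> x; have [a [b [a' [b' [d [? ? ? xE]]]]]] := dec x.
  by exists b, a, a', b', d.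
have [||t tP] := @semisimple_selection _ _ ssV
  [set p | exists a b b' d,
     [/\ G (a, b), G (p.2, b'), D d & p.1 = a + b' + d]].
- split=> [|c [? b1] [? b2]].
    by exists 0, 0, 0, 0; split=> //; [exact: submodule0|rewrite !addr0].
  move=> [a1 [a1' [b1' [d1 [/= G1 G1' D1 ->]]]]].
  move=> [a2 [a2' [b2' [d2 [/= G2 G2' D2 ->]]]]].
  exists (c *: a1 + a2), (c *: a1' + a2'), (c *: b1' + b2'), (c *: d1 + d2).
  split; [exact: GL|exact: GL|exact: sD.2|].
  by rewrite /= !scalerDr addrACA (addrACA (c *: a1)).
- move=> x; have [a [b [a' [b' [d [? ? ? xE]]]]]] := dec x.
  by exists a', a, b, b', d.
have sE a b a' b' d : G (a, b) -> G (a', b') -> D d -> s (a + b' + d) = b.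
  move=> G1 G2 Dd.
  have [a1 [a1' [b1' [d1 [/= G3 G4 Dd1 e]]]]] := sP (a + b' + d).
  by have [-> //] := decU _ _ _ _ _ _ _ _ _ _ G1 G2 Dd G3 G4 Dd1 e.
have tE a b a' b' d : G (a, b) -> G (a', b') -> D d -> t (a + b' + d) = a'.
  move=> G1 G2 Dd.
  have [a1 [a1' [b1' [d1 [/= G3 G4 Dd1 e]]]]] := tP (a + b' + d).
  by have [_ -> //] := decU _ _ _ _ _ _ _ _ _ _ G1 G2 Dd G3 G4 Dd1 e.
have D0 : D 0 := submodule0 sD.
have sA a b : G (a, b) -> s a = b.
  by move=> Gab; have := sE _ _ _ _ _ Gab G00 D0; rewrite !addr0.
have sB a b : G (a, b) -> s b = 0.
  by move=> Gab; have := sE _ _ _ _ _ G00 Gab D0; rewrite add0r addr0.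
have tB a b : G (a, b) -> t b = a.
  by move=> Gab; have := tE _ _ _ _ _ G00 Gab D0; rewrite add0r addr0.
pose e := s * t; pose d : endo V := 1 - (e + t * s).
have dE a b a' b' c : G (a, b) -> G (a', b') -> D c -> d (a + b' + c) = c.
  move=> G1 G2 Dc; rewrite endo_subE endo_addE !endo_mulE endo_1E.
  rewrite (sE _ _ _ _ _ G1 G2 Dc) (tE _ _ _ _ _ G1 G2 Dc).
  by rewrite (sA _ _ G2) (tB _ _ G1) (addrC b') addrAC subrr add0r.
have dD c : D c -> d c = c.
  by move=> Dc; have := dE _ _ _ _ _ G00 G00 Dc; rewrite addr0 add0r.
have dA a b : G (a, b) -> d a = 0.
  by move=> Gab; have := dE _ _ _ _ _ Gab G00 D0; rewrite !addr0.
have dB a b : G (a, b) -> d b = 0.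
  by move=> Gab; have := dE _ _ _ _ _ G00 Gab D0; rewrite addr0 add0r.
have sts : s * t * s = s.
  apply/endo_eqP => x; have [a [b [a' [b' [c [G1 G2 Dc ->]]]]]] := dec x.
  by rewrite !endo_mulE (sE _ _ _ _ _ G1 G2 Dc) (tB _ _ G1) (sA _ _ G1).
have ss0 : s * s = 0.
  apply/endo_eqP => x; have [a [b [a' [b' [c [G1 G2 Dc ->]]]]]] := dec x.
  by rewrite !endo_mulE (sE _ _ _ _ _ G1 G2 Dc) (sB _ _ G1).
have is_ : unit_ideal s.
  have -> : s = e * s * (1 - e).
    by rewrite sts mulrBr mulr1 mulrA ss0 mul0r subr0.
  apply: (unit_ideal_corner (semisimple_regular ssV)).
  by rewrite /e mulrA sts.
have ddE : d * d = d.
  apply/endo_eqP => x; have [a [b [a' [b' [c [G1 G2 Dc ->]]]]]] := dec x.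
  by rewrite endo_mulE (dE _ _ _ _ _ G1 G2 Dc) dD.
exists d; split=> //.
  rewrite opprB addrC subrK.
  by apply: unit_idealD; [apply: unit_idealMr|apply: unit_idealMl].
move=> n dnd nn0.
have dn : d * n = n by rewrite -dnd !mulrA ddE.
have nd : n * d = n by rewrite -dnd -mulrA ddE.
have [k nkn] := semisimple_regular ssV n.
(* On the image of j, a complement of the kernel of n in D, the map n is
   injective, and j v |-> n v is the isomorphism by which H extends G. *)
have [j [dj nj jE]] : exists j,
    [/\ d * j = j, n * j = n & forall v, n v = 0 -> j v = 0].
  exists (d * k * n); split; rewrite ?mulrA ?ddE ?nd ?nkn // => v nv.
  by rewrite endo_mulE nv linear0.
pose H := [set p : V * V | exists a b v, G (a, b) /\ p = (a + j v, b + n v)].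
have pH : pairing H.
  split; first split.
  - by exists 0, 0, 0; rewrite !linear0 !addr0.
  - move=> c _ _ [a [b [v [G1 ->]]]] [a' [b' [v' [G2 ->]]]].
    exists (c *: a + a'), (c *: b + b'), (c *: v + v'); split; first exact: GL.
    by rewrite !linearP; congr pair; rewrite /= scalerDr addrACA.
  move=> _ _ _ [a [b [v [G1 [-> ->]]]]] [a' [b' [v' [G2 [yE ->]]]]].
  have njv : n v = j v'.
    have := congr1 d yE; rewrite !linearD (dB _ _ G1) (dA _ _ G2) !add0r.
    by rewrite -!endo_mulE dn dj.
  have ba' : b = a' by move: yE; rewrite njv => /addIr.
  rewrite -ba' in G2; have [-> ->] := sepG _ _ _ G1 G2.
  have nv' : n v' = 0 by rewrite -nj endo_mulE -njv -endo_mulE nn0.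
  have nv : n v = 0 by rewrite njv jE.
  by rewrite nv' jE // addr0.
apply/endo_eqP => x; have Hx : H (j x, n x) by exists 0, 0, x; rewrite !add0r.
have GH : G `<=` H.
  by move=> [a b] Gab; exists a, b, 0; rewrite !linear0 !addr0.
by have := dB _ _ (maxG H pH GH _ Hx); rewrite -endo_mulE dn.
Qed.

End Pairings.

(** * Superfluous submodules and the radical over a perfect ring *)

Section Superfluous.
Variable S : pzRingType.
Implicit Types P Q V M W : lmodType S.
Local Open Scope classical_set_scope.

Lemma linear_factor P M W (p : {linear P -> M}) (f : {linear P -> W}) :
  epimorphism p -> (forall x, p x = 0 -> f x = 0) ->
  exists g : {linear M -> W}, g \o p =1 f.
Proof.
move=> epip kerp; pose r m := sval (cid (epip m)).
have rE m : p (r m) = m := svalP (cid (epip m)).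
have frE x m : p x = m -> f x = f (r m).
  move=> pm; apply/eqP; rewrite -subr_eq0 -linearB; apply/eqP/kerp.
  by rewrite linearB rE pm subrr.
have [|g gE] := @linear_of _ _ _ (f \o r).
  by move=> a x y /=; rewrite -linearP; apply/esym/frE; rewrite linearP !rE.
by exists g => x /=; rewrite gE /=; apply/esym/frE.
Qed.

Definition superfluous P (K : set P) := forall X : set P, submodule X ->
  (forall y, exists2 k, K k & X (y - k)) -> forall y, X y.

Lemma submodule_kernel P M (f : {linear P -> M}) : submodule [set x | f x = 0].
Proof.
split=> [|a x y /= fx fy]; first exact: linear0.
by rewrite linearP fx fy scaler0 addr0.
Qed.

Definition cyclic P (x : P) : set P := [set y | exists a, y = a *: x].

(** The sum of all superfluous submodules, described by its elements. *)
Definition radical P (x : P) := superfluous (cyclic x).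

Lemma superfluousS P (K L : set P) :
  superfluous L -> K `<=` L -> superfluous K.
Proof.
move=> sL KL X sX KX; apply: sL => // y.
by have [k /KL Lk Xk] := KX y; exists k.
Qed.

Lemma superfluous0 P : superfluous [set (0 : P)].
Proof. by move=> X sX X0 y; have [_ -> ] := X0 y; rewrite subr0. Qed.

Lemma superfluousD P (K L : set P) :
  superfluous K -> superfluous L -> submodule L ->
  superfluous [set x | exists k l, [/\ K k, L l & x = k + l]].
Proof.
move=> sK sL mL X sX KLX; apply: sL => //.
suff: forall y, [set y | exists2 l, L l & X (y - l)] y by [].
apply: sK => [|y].
  split=> [|a x y [l Ll Xl] [l' Ll' Xl']].
    by exists 0; rewrite ?subr0; apply: submodule0.
  exists (a *: l + l'); first exact: mL.2.
  by rewrite opprD addrACA -scalerBr; apply: sX.2.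
have [_ [k [l [Kk Ll ->]] Xy]] := KLX y; exists k => //; exists l => //.
by rewrite -addrA -opprD.
Qed.

Lemma superfluous_image P Q (h : {linear P -> Q}) (K : set P) :
  superfluous K -> superfluous (h @` K).
Proof.
move=> sK X sX KX.
have hX : forall x, [set x | X (h x)] x.
  apply: sK => [|x].
    split=> [|a x y /= Xx Xy]; first by rewrite /= linear0; apply: submodule0.
    by rewrite linearP; apply: sX.2.
  by have [_ [k Kk <-] Xk] := KX (h x); exists k => //=; rewrite linearB.
move=> y; have [_ [k Kk <-] Xk] := KX y.
by rewrite -[y](subrK (h k)); apply: submoduleD sX Xk (hX k).
Qed.

Lemma submodule_cyclic P (x : P) : submodule (cyclic x).
Proof.
split=> [|a _ _ [b ->] [c ->]]; first by exists 0; rewrite scale0r.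
by exists (a * b + c); rewrite scalerDl scalerA.
Qed.

Lemma submodule_radical P : submodule (@radical P).
Proof.
split=> [|a x y rx ry].
  by refine (superfluousS (@superfluous0 P) _) => _ [a ->]; rewrite scaler0.
refine (superfluousS (superfluousD rx ry (submodule_cyclic y)) _) => _ [b ->].
exists (b * a *: x), (b *: y); split; [by eexists|by eexists|].
by rewrite scalerDr scalerA.
Qed.

Lemma radical_image P Q (h : {linear P -> Q}) x : radical x -> radical (h x).
Proof.
move=> rx; refine (superfluousS (superfluous_image (h := h) rx) _) => _ [a ->].
by exists (a *: x); [exists a|rewrite linearZ].
Qed.

(** If X and the kernel generate P, then P has an endomorphism h with values in
    X such that p h = p; by minimality of the cover, h is onto. *)
Lemma superfluous_kernel P M (p : {linear P -> M}) :
  projective_cover p -> superfluous [set x | p x = 0].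
Proof.
move=> [prP _ _ minp] X sX kX.
have [||h hX] :=
  @projective_selection _ _ _ [set z | X z.2 /\ p z.2 = p z.1] prP.
- split=> [|a [x y] [x' y'] [/= Xy e] [/= Xy' e']].
    by split; rewrite /= ?linear0 //; apply: submodule0.
  by split; [apply: sX.2|rewrite /= !linearP e e'].
- move=> x; have [k /= pk Xk] := kX x; exists (x - k); split=> //=.
  by rewrite linearB pk subr0.
have [|g _ hg] := minp h; first by move=> x; have [_ /= ->] := hX x.
by move=> y; rewrite -[y]hg; have [] := hX (g y).
Qed.

Lemma sub_superfluous_surjective P (h : {linear P -> P}) :
  superfluous (range h) -> forall y, exists x, x - h x = y.
Proof.
move=> sh; apply: sh => [|y].
  split=> [|a _ _ [x <-] [y <-]]; first by exists 0; rewrite linear0 subr0.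
  by exists (a *: x + y); rewrite linearP opprD addrACA -scalerBr.
by exists (h y); [exists y|exists y].
Qed.

(** The map 1 - h is onto, so it has a section s by projectivity. As
    s = 1 + h s and h s also has superfluous image, s is onto too, hence the
    inverse of 1 - h. *)
Lemma sub_superfluous_automorphism P (h : {linear P -> P}) :
  projective P -> superfluous (range h) -> automorphism (idfun \- h).
Proof.
move=> prP sh; have epih := sub_superfluous_surjective sh.
have [s sE] :=
  prP _ _ (idfun \- h : {linear P -> P}) (idfun : {linear P -> P}) epih.
have sh' : superfluous (range (\- (h \o s) : {linear P -> P})).
  refine (superfluousS sh _) => _ [x _ <-]; exists (- s x) => //=.
  by rewrite linearN.
have epis y : exists x, s x = y.
  have [x xE] := sub_superfluous_surjective sh' y.
  exists x; rewrite -xE /= opprK.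
  by have := sE x => /= {2}<-; rewrite subrK.
exists s => [y|x]; last exact: sE.
by have [x <-] := epis y; rewrite [X in s X](sE x).
Qed.

Lemma superfluous_cyclic_sum P (s : seq P) : (forall x : P, radical x) ->
  superfluous [set z | exists2 f : P -> P, forall x, cyclic x (f x)
                                        & z = \sum_(x <- s) f x].
Proof.
move=> rP; elim: s => [|x s IH].
  by refine (superfluousS (@superfluous0 P) _) => _ [f _ ->]; rewrite big_nil.
refine (superfluousS (superfluousD IH (rP x) (submodule_cyclic x)) _).
move=> _ [f fE ->]; exists (\sum_(y <- s) f y), (f x).
by rewrite big_cons addrC; split=> //; exists f.
Qed.

(** A variant of a theorem of Bass. The direct sum of all cyclic submodules maps
    onto P, so P projective gives linear maps s_x from P to the cyclic submodule
    of x, for x in P, such that each q is the sum of finitely many s_x q. For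
    fixed q, the sum h of those s_x has image in a finite sum of cyclic, hence
    superfluous, submodules. So 1 - h is an automorphism, and it kills q. *)
Lemma projective_radical_eq0 P :
  projective P -> (forall x : P, radical x) -> forall x : P, x = 0.
Proof.
move=> prP rP q.
(* A family z.2 has sum z.1 when its sums over all large enough finite sets are
   equal to z.1; in this form, families and sums can be added directly. *)
have [||s sE] := @projective_selection _ _ _ [set z : P * (P -> P) |
  (forall x, cyclic x (z.2 x)) /\ exists s : seq P, forall t, uniq t ->
    {subset s <= t} -> \sum_(x <- t) z.2 x = z.1] prP.
- split=> [|a [x f] [y g] [/= fc [s sE]] [/= gc [t tE]]].
    split=> [x|]; first exact: (submodule0 (submodule_cyclic x)).
    by exists [::] => t _ _; rewrite big1.
  split=> [z|]; first exact: (submodule_cyclic z).2.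
  exists (s ++ t) => r ur str; rewrite /= big_split /= -scaler_sumr.
  rewrite sE // ?tE // => z zs; apply: str; rewrite mem_cat zs ?orbT //.
- move=> x; exists (fun y => if y == x then x else 0); split=> [y|] /=.
    case: eqP => [->|_]; first by exists 1; rewrite scale1r.
    exact: (submodule0 (submodule_cyclic y)).
  exists [:: x] => t ut xt; rewrite (bigD1_seq x) //= ?eqxx; last first.
    by apply: xt; rewrite inE.
  by rewrite big1 ?addr0 // => y /negbTE ->.
have [_ [r rE]] := sE q.
have [|h hE] := @linear_of _ _ _ (fun x => \sum_(y <- undup r) s x y).
  move=> a x y; rewrite scaler_sumr -big_split /=.
  by apply: eq_bigr => z _; rewrite linearP.
have sh : superfluous (range h).
  refine (superfluousS (superfluous_cyclic_sum (s := undup r) rP) _).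
  by move=> _ [x _ <-]; exists (s x); [have [] := sE x|rewrite hE].
have hq : h q = q.
  by rewrite hE rE ?undup_uniq // => z; rewrite mem_undup.
have /bij_inj inj := sub_superfluous_automorphism prP sh.
by apply: inj; rewrite /= hq subrr linear0 subrr.
Qed.

Definition perfect :=
  forall M, exists P (p : {linear P -> M}), projective_cover p.

(** The image of a lift and the superfluous kernel of the cover generate Q. *)
Lemma cover_lift_surjective P Q M (c : {linear Q -> M}) (f : {linear P -> M})
    (a : {linear P -> Q}) :
  projective_cover c -> epimorphism f -> c \o a =1 f -> epimorphism a.
Proof.
move=> cc epif ca; have := superfluous_kernel cc; apply.
  split=> [|b _ _ [x <-] [y <-]]; first by exists 0; rewrite linear0.
  by exists (b *: x + y); rewrite linearP.
move=> y; have [x fx] := epif (c y); exists (y - a x) => /=.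
  by rewrite linearB [c (a x)]ca fx subrr.
by exists x; rewrite opprB subrKC.
Qed.

Lemma quotmod_proj_epi V (N : submodClosed V) : epimorphism (quotmod_proj N).
Proof. exact: quotmod_proj_surj. Qed.

Lemma quotmod_proj_eq0 V (N : submodClosed V) x :
  quotmod_proj N x = 0 <-> x \in N.
Proof.
have := quotmod_projP N x 0; rewrite subr0 linear0; exact.
Qed.

(** If X and the radical generate P, then the projective cover Q of P/X is
    generated by the image of the radical and a superfluous kernel. So Q is its
    own radical and vanishes by projective_radical_eq0. *)
Lemma radical_superfluous P :
  perfect -> projective P -> superfluous (@radical P).
Proof.
move=> perf prP X sX rX; have [N NE] := submodule_submodClosed sX.
have [Q [c cc]] := perf (quotmod N); have [prQ _ liftc _] := cc.
have [a aE] := liftc _ (quotmod_proj N) prP.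
have epia := cover_lift_surjective cc (@quotmod_proj_epi _ N) aE.
have rQ : forall q : Q, radical q.
  have := superfluous_kernel cc; apply; first exact: submodule_radical.
  move=> q; have [y <-] := epia q; have [z rz /NE Xyz] := rX y.
  exists (a (y - z)); first by rewrite /= [c _]aE; apply/quotmod_proj_eq0.
  by rewrite -linearB subKr; apply: radical_image.
move=> y; apply/NE/quotmod_proj_eq0; rewrite -aE /=.
by rewrite (projective_radical_eq0 prQ rQ (a y)) linear0.
Qed.

(** Given a submodule X of P/N, the projective cover Q of the quotient by X is a
    direct summand of P. Its image in P/N is a complement of X: the
    intersection comes from the kernel of the cover of Q, which is superfluous
    and hence in the radical. *)
Lemma semisimple_top P (N : submodClosed P) : perfect -> projective P ->
  (forall x : P, radical x -> x \in N) -> semisimple (quotmod N).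
Proof.
move=> perf prP rN X sX; have [L LE] := submodule_submodClosed sX.
have [Q [c cc]] := perf (quotmod L); have [prQ _ liftc _] := cc.
pose f : {linear P -> quotmod L} := quotmod_proj L \o quotmod_proj N.
have epif : epimorphism f.
  move=> w; have [v <-] := quotmod_proj_epi w.
  by have [x <-] := quotmod_proj_epi v; exists x.
have [a aE] := liftc _ f prP.
have epia := cover_lift_surjective cc epif aE.
have [i iE] := prQ _ _ a (idfun : {linear Q -> Q}) epia.
exists (range (quotmod_proj N \o i)); split.
- split=> [|b _ _ [x _ <-] [y _ <-]]; first by exists 0; rewrite // linear0.
  by exists (b *: x + y); rewrite // linearP.
- move=> v; have [y <-] := quotmod_proj_epi v.
  exists (quotmod_proj N (y - i (a y))), (quotmod_proj N (i (a y))); split.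
  + apply/LE/quotmod_proj_eq0; rewrite -[LHS]/(f _) linearB -!aE /=.
    by rewrite [a (i _)]iE subrr.
  + by exists (a y).
  + by rewrite -linearD subrK.
move=> v Xv [q _ qv]; move: Xv; rewrite -qv => Xq.
apply/quotmod_proj_eq0/rN; refine (radical_image (h := i) _).
refine (superfluousS (superfluous_kernel cc) _) => _ [b ->] /=.
apply: (submoduleZ b (submodule_kernel c)).
have /= cq := aE (i q); rewrite [a _]iE in cq.
by apply: (etrans cq); apply/quotmod_proj_eq0/LE.
Qed.

End Superfluous.

(** * Sums of automorphisms of a projective module *)

Section Top.
Variables (S : pzRingType) (P : lmodType S) (Z : submodClosed P).
Hypothesis perf : perfect S.
Hypothesis prP : projective P.
Hypothesis ZE : forall x, (x \in Z) <-> radical x.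
Local Notation top := (quotmod Z).
Local Notation q := (quotmod_proj Z).

Lemma top_proj_eq0 x : q x = 0 <-> radical x.
Proof. by split=> [/quotmod_proj_eq0/ZE|/ZE/quotmod_proj_eq0]. Qed.

Lemma top_endo (h : {linear P -> P}) :
  exists hb : endo top, forall x, hb (q x) = q (h x).
Proof.
have [x /top_proj_eq0 rx|hb hbE] :=
    linear_factor (f := q \o h : {linear P -> top}) (@quotmod_proj_epi _ _ Z).
  by apply/top_proj_eq0; apply: (radical_image (h := h) rx).
by exists hb => x; apply: hbE.
Qed.

Lemma top_endo_lift (f : endo top) :
  exists h : {linear P -> P}, forall x, q (h x) = f (q x).
Proof.
have [h hE] := prP (f \o q : {linear P -> top}) (@quotmod_proj_epi _ _ Z).
by exists h => x; apply: hE.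
Qed.

Lemma sub_radical_automorphism (h : {linear P -> P}) :
  (forall x, q (h x) = 0) -> automorphism (idfun \- h).
Proof.
move=> qh; apply: (sub_superfluous_automorphism prP).
refine (superfluousS (radical_superfluous perf prP) _) => _ [x _ <-].
exact: (top_proj_eq0 _).1 (qh x).
Qed.

(** If f has inverse g, and k lifts g, then h k and k h are automorphisms. *)
Lemma top_automorphism_lift (f : endo top) (h : {linear P -> P}) :
  invertible f -> (forall x, q (h x) = f (q x)) -> automorphism h.
Proof.
move=> [g fg gf] hE; have [k kE] := top_endo_lift g.
have fgE v : f (g v) = v by rewrite -endo_mulE fg.
have gfE v : g (f v) = v by rewrite -endo_mulE gf.
have [|u _ hku] := @sub_radical_automorphism (idfun \- (h \o k)).
  by move=> x; rewrite linearB /= hE kE fgE subrr.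
have [|w khw _] := @sub_radical_automorphism (idfun \- (k \o h)).
  by move=> x; rewrite linearB /= kE hE gfE subrr.
have hK y : h (k (u y)) = y by have /= := hku y; rewrite subKr.
have injh : injective h.
  by move=> x y hxy; apply: (can_inj khw); rewrite /= !subKr hxy.
by exists (k \o u) => // x; apply: injh; rewrite /= hK.
Qed.

Variables (M : lmodType S) (p : {linear P -> M}).
Hypothesis coP : coinvariant_along p.

Lemma coinvariant_unit_span_lift (f : endo top) : unit_span f ->
  exists2 h : {linear P -> P}, forall x, q (h x) = f (q x)
    & exists g : {linear M -> M}, forall x, g (p x) = p (h x).
Proof.
elim=> [|u f' iu _ [h hE [g gE]]].
  exists \0 => [x|]; first exact: linear0.
  by exists \0 => x; rewrite linear0.
have [k kE] := top_endo_lift u.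
have [g' g'E] := coP (top_automorphism_lift iu kE).
exists (k \+ h) => [x|]; first by rewrite linearD /= kE hE.
by exists (g' \+ g) => x; rewrite linearD /= gE [g' _]g'E.
Qed.

(** Two endomorphisms with the same action on the top differ by some r with
    values in the radical, and r = 1 - (1 - r) is a difference of
    automorphisms. *)
Lemma coinvariant_unit_span (f : endo top) (t : {linear P -> P}) :
  unit_span f -> (forall x, q (t x) = f (q x)) ->
  exists g : {linear M -> M}, forall x, g (p x) = p (t x).
Proof.
move=> /coinvariant_unit_span_lift[h hE [g gE]] tE.
have [|g' g'E] := coP (@sub_radical_automorphism (h \- t) _).
  by move=> x; rewrite linearB /= hE tE subrr.
exists (g \+ (g' \- idfun)) => x.
have g'x : g' (p x) = p (x - (h x - t x)) := g'E x.
rewrite /= gE g'x -linearB -linearD; congr (p _).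
by rewrite addrAC subrr add0r opprB subrKC.
Qed.

(** On the top, which is semisimple, x + (1 - x y) is a sum of units. *)
Lemma coinvariant_partial_iso (x y : {linear P -> P}) :
  (forall z, x (y (x z)) = x z) -> (forall z, y (x (y z)) = y z) ->
  exists g : {linear M -> M}, forall z, g (p z) = p (x z + (z - x (y z))).
Proof.
move=> xyx yxy; have ssV : semisimple top.
  by apply: semisimple_top perf prP _ => z /ZE.
have [d [dd idd redd]] := exists_reduced_corner ssV.
have [xb xbE] := top_endo x; have [yb ybE] := top_endo y.
have xyxb : xb * yb * xb = xb.
  apply/endo_eqP => v; have [z <-] := quotmod_proj_epi v.
  by rewrite !endo_mulE xbE ybE xbE xyx.
have yxyb : yb * xb * yb = yb.
  apply/endo_eqP => v; have [z <-] := quotmod_proj_epi v.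
  by rewrite !endo_mulE ybE xbE ybE yxy.
have := unit_span_partial_iso (semisimple_regular ssV) dd idd redd xyxb yxyb.
move/(coinvariant_unit_span (t := x \+ (idfun \- (x \o y)))); apply=> z.
have -> : (xb + (1 - xb * yb)) (q z) = xb (q z) + (q z - xb (yb (q z))) by [].
by rewrite ybE !xbE -linearB -linearD.
Qed.

End Top.

(** * Coinvariance and pseudo-projectivity *)

Section Coinvariance.
Variables (S : pzRingType) (P M : lmodType S) (p : {linear P -> M}).
Hypothesis cp : projective_cover p.
Local Open Scope classical_set_scope.

(** Write the epimorphisms P -> M/N given by the projection and by phi as c a
    and c b through the projective cover c of M/N. With sections i of a and j
    of b, the endomorphism t = i b + (1 - i b j a) of P satisfies c a t = c b,
    as c a (i b) = c b and c a (i b j a) = c a. *)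
Lemma coinvariant_along_pseudo_projective :
  perfect S -> coinvariant_along p -> pseudo_projective M.
Proof.
move=> perf co N phi epiphi; have [prP epip _ _] := cp.
have [Z ZE] := submodule_submodClosed (@submodule_radical _ P).
have [Q [c cc]] := perf (quotmod N); have [prQ _ liftc _] := cc.
pose al : {linear P -> quotmod N} := quotmod_proj N \o p.
pose be : {linear P -> quotmod N} := phi \o p.
have epial : epimorphism al.
  move=> w; have [m <-] := quotmod_proj_epi w; have [x <-] := epip m.
  by exists x.
have epibe : epimorphism be.
  by move=> w; have [m <-] := epiphi w; have [x <-] := epip m; exists x.
have [a aE] := liftc _ al prP; have [b bE] := liftc _ be prP.
have [i iE] := prQ _ _ a (idfun : {linear Q -> Q})
  (cover_lift_surjective cc epial aE).
have [j jE] := prQ _ _ b (idfun : {linear Q -> Q})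
  (cover_lift_surjective cc epibe bE).
have iK z : a (i z) = z := iE z.
have jK z : b (j z) = z := jE z.
have alE z : c (a z) = al z := aE z.
have beE z : c (b z) = be z := bE z.
have [||g gE] :=
  coinvariant_partial_iso perf prP ZE co (x := i \o b) (y := j \o a).
- by move=> z; rewrite /= iK jK.
- by move=> z; rewrite /= iK jK.
exists g => m; have [z <-] := epip m.
have -> : (quotmod_proj N \o g) (p z) =
    al ((i \o b) z + (z - (i \o b) ((j \o a) z))) by rewrite /= gE.
by rewrite linearD linearB -!alE /= !iK jK subrr addr0 beE.
Qed.

(** The map p phi factors through p modulo N = p (phi (ker p)), so
    pseudo-projectivity provides psi with psi p = p phi modulo N. The
    congruence is an equality because ker p is superfluous. *)
Lemma pseudo_projective_coinvariant_along :
  pseudo_projective M -> coinvariant_along p.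
Proof.
move=> psM phi [phi' phiK phi'K]; have [prP epip _ _] := cp.
have sN : submodule [set m | exists2 x, p x = 0 & m = p (phi x)].
  split=> [|a _ _ [x px ->] [y py ->]]; first by exists 0; rewrite !linear0.
  exists (a *: x + y); last by rewrite !linearP.
  by rewrite linearP px py scaler0 addr0.
have [N NE] := submodule_submodClosed sN.
have [|f fE] := linear_factor (p := p) (f := quotmod_proj N \o (p \o phi)) epip.
  by move=> x px; apply/quotmod_proj_eq0/NE; exists x.
have [|psi psiE] := psM N f.
  move=> w; have [m <-] := quotmod_proj_epi w; have [x <-] := epip m.
  by exists (p (phi' x)); rewrite [f _]fE /= phi'K.
exists psi; have [h hE] := prP _ _ p (psi \o p) epip.
(* The submodule where p h and p phi agree generates P with the kernel of p. *)
suff agree : forall x, [set x | p (h x) = p (phi x)] x.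
  by move=> x; rewrite -hE /=; apply: agree.
refine (superfluous_kernel cp (X := _) _ _) => [|y].
  split=> [|a x y /= ex ey]; first by rewrite /= !linear0.
  by rewrite !linearP ex ey.
have /NE[x px e] : p (h y) - p (phi y) \in N.
  have psiy : quotmod_proj N (psi (p y)) = f (p y) := psiE (p y).
  have fy : f (p y) = quotmod_proj N (p (phi y)) := fE y.
  have hy : p (h y) = psi (p y) := hE y.
  by apply/quotmod_projP; rewrite hy psiy fy.
(* Adding x to y adds p (phi x) to p (phi y) and leaves p (h y) unchanged. *)
exists (- x); rewrite /= ?linearN ?px ?oppr0 // opprK !linearD.
by rewrite -[p (h x)]/((p \o h) x) hE /= px linear0 addr0 -e subrKC.
Qed.

End Coinvariance.

Theorem theorem2p3 (R : pzRingType) (M : lmodType R^c) :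
  right_perfect R -> automorphism_coinvariant M <-> pseudo_projective M.
Proof.
move=> perf; split=> [[P [p [cp co]]]|psM].
  exact: coinvariant_along_pseudo_projective cp perf co.
have [P [p cp]] := perf M; exists P, p; split=> //.
exact: pseudo_projective_coinvariant_along.
Qed.
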